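(* For every compact $T$-measurable space $(X,\mathcal{A})$, $X\cong\max(M(X))$ as measurable spaces, where $\max(M(X))$ is equipped with the collection of measurable sets $\{\mathcal{F}(f): f\in M(X)\}$.
   Context: A measurable space $(X,\mathcal{A})$ is a nonempty set $X$ with a $\sigma$-algebra $\mathcal{A}$ of subsets of $X$. $M(X)$ is the commutative ring (pointwise operations) of all functions $f:X\to\mathbb{R}$ with $f^{-1}(V)\in\mathcal{A}$ for every open $V\subseteq\mathbb{R}$. A measurable space is $T$-measurable if whenever $x,y$ are distinct points of it, there is a measurable set containing one of them and not the other. $(X,\mathcal{A})$ is a compact measurable space if $\mathcal{A}$, ordered by inclusion, is a compact lattice, i.e. its top element $X$ is compact: whenever $X=\bigvee S$ with $S\subseteq\mathcal{A}$, there is a finite $T\subseteq S$ with $X=\bigvee T$. A compact $T$-measurable space is a measurable space that is both compact and $T$-measurable. $\max(M(X))$ is the set of all maximal ideals of $M(X)$, and for $f\in M(X)$, $\mathcal{F}(f)=\{M\in\max(M(X)): f\in M\}$. For compact $T$-measurable $(X,\mathcal{A})$ the collection $\{\mathcal{F}(f): f\in M(X)\}$ is a $\sigma$-algebra on $\max(M(X))$. Two measurable spaces $(X_1,\mathcal{A}_1)$ and $(X_2,\mathcal{A}_2)$ are homeomorphic, written $X_1\cong X_2$, if there is a bijection $\varphi:X_1\to X_2$ such that for every $A\subseteq X_1$, $A\in\mathcal{A}_1$ if and only if $\varphi(A)\in\mathcal{A}_2$. *)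

(* Defs.v *)
From HB Require Import structures.
From mathcomp Require Import all_boot all_order all_algebra.
From mathcomp Require Import all_classical all_reals all_analysis.
(* [all_analysis] does not export the ring structure on [{mfun X >-> R}]. *)
From mathcomp Require Import measurable_realfun.

Set Implicit Arguments.
Unset Strict Implicit.
Unset Printing Implicit Defensive.

Import Order.TTheory GRing.Theory Num.Theory.
Import numFieldNormedType.Exports.

Local Open Scope classical_set_scope.
Local Open Scope ring_scope.

(* The join of [S] is computed in the poset [G] ordered by inclusion: it is the
   least upper bound among the members of [G], which may be strictly larger
   than the union of [S]. *)
Definition is_join (T : Type) (G S : set (set T)) (U : set T) : Prop :=
  [/\ G U,
      forall A, S A -> A `<=` U &
      forall V, G V -> (forall A, S A -> A `<=` V) -> U `<=` V].

Definition compact_in (T : Type) (G : set (set T)) (U : set T) : Prop :=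
  forall S : set (set T), S `<=` G -> is_join G S U ->
    exists S' : set (set T),
      [/\ finite_set S', S' `<=` S & is_join G S' U].

Definition compact_measurable_space d (X : measurableType d) : Prop :=
  compact_in (@measurable d X) [set: X].

Definition T_measurable_space d (X : measurableType d) : Prop :=
  forall x y : X, x <> y ->
    exists A : set X, measurable A /\ ((A x /\ ~ A y) \/ (A y /\ ~ A x)).

(* [{mfun X >-> R}] asks for measurable preimages of Borel sets; by
   [measurable_fun_openP] this is the same as asking it for open sets only. *)
Definition meas_ring d (X : measurableType d) (R : realType) : comNzRingType :=
  {mfun X >-> R}.

Lemma measurable_fun_openP d (X : measurableType d) (R : realType)
    (f : X -> R) :
  measurable_fun [set: X] f <->
  (forall V : set R, open V -> measurable (f @^-1` V)).
Proof.
split=> [mf V oV|fV].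
  by rewrite -[_ @^-1` _]setTI; apply: mf => //; exact: open_measurable.
apply: (measurability (@RGenOpens.G R)) => [|_ [_ [a [b ->] <-]]].
  exact: RGenOpens.measurableE.
by rewrite setTI; apply: fV; exact: interval_open.
Qed.

(* [idealr_closed] includes properness (it requires that 1 is not a member). *)
Definition maximal_ideal (A : comNzRingType) (I : set A) : Prop :=
  idealr_closed (mem I) /\
  forall J : set A, idealr_closed (mem J) -> I `<=` J -> J = I.

Definition max_spec (A : comNzRingType) : Type :=
  {I : set A | maximal_ideal I}.

Definition zero_set (A : comNzRingType) (f : A) : set (max_spec A) :=
  [set I : max_spec A | sval I f].

Definition max_spec_measurable (A : comNzRingType) : set (set (max_spec A)) :=
  range (@zero_set A).

Definition measurably_homeomorphic (X1 X2 : Type)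
    (A1 : set (set X1)) (A2 : set (set X2)) : Prop :=
  exists2 phi : X1 -> X2, bijective phi &
    forall A : set X1, A1 A <-> A2 (phi @` A).

(* Main.v *)
Require Import Defs.
From mathcomp Require Import all_boot all_order all_algebra.
From mathcomp Require Import all_classical all_reals all_analysis.
From mathcomp Require Import measurable_realfun.

(** Compactness of the lattice of measurable sets is so strong that, together
    with separation of points, it forces [X] to be a finite set all of whose
    subsets are measurable.

    First, every singleton [[set x]] is measurable
    ([compact_T_measurable_set1]).  The measurable sets missing [x] cover
    everything but [x]; if [[set x]] were not measurable, the only measurable
    set above all of them would be [X], so their join would be [X].  Finitely
    many of them would then already have join [X]; but the join of finitely
    many measurable sets is their union, which misses [x].  Secondly, the
    singletons now have join [X], and finitely many of them must cover [X]
    ([compact_measurable_finite]).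

    So the ring is the ring of all functions on a finite set.  Evaluation at
    [x] has as kernel a maximal ideal [vanishing_ideal R x], and distinct
    points give distinct ideals because a measurable set separates them.
    Finiteness makes every maximal ideal of this form: an ideal that contains,
    for each [x], some function nonzero at [x] contains all indicators of
    points, hence their sum, which is 1.  Under the bijection
    [x |-> vanishing_ideal R x], the set [zero_set f] corresponds to the zeros
    of [f]; since every subset of [X] is the zero set of the indicator of its
    complement, both collections of measurable sets are full power sets. *)

Set Implicit Arguments.
Unset Strict Implicit.

Import GRing.Theory.

Local Open Scope ring_scope.
Local Open Scope classical_set_scope.

(** * Compact lattices of measurable sets *)

(** A finite union of measurable sets is measurable, so it is itself an upper
    bound in the lattice: finite joins are unions, whereas an infinite join may
    be larger than the union. *)
Lemma finite_join_bigcup d (X : measurableType d) (S : set (set X)) :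
  finite_set S -> S `<=` measurable -> is_join measurable S [set: X] ->
  forall x, exists2 A, S A & A x.
Proof.
move=> finS mS [_ _ lubS] x.
have /(_ x I) [A SA Ax] : [set: X] `<=` \bigcup_(A in S) A.
  apply: lubS; last by move=> A SA y Ay; exists A.
  by apply: fin_bigcup_measurable.
by exists A.
Qed.

Lemma T_measurable_separate d (X : measurableType d) (x y : X) :
  T_measurable_space X -> x <> y -> exists A, [/\ measurable A, A y & ~ A x].
Proof.
move=> hT /hT [A [mA [[Ax nAy]|[Ay nAx]]]]; last by exists A.
by exists (~` A); split=> //; exact: measurableC.
Qed.

Lemma compact_T_measurable_set1 d (X : measurableType d) (x : X) :
  compact_measurable_space X -> T_measurable_space X -> measurable [set x].
Proof.
move=> hC hT; apply: contrapT => nmx.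
pose S : set (set X) := [set A | measurable A /\ ~ A x].
have Sm : S `<=` measurable by move=> A [].
have joinS : is_join measurable S [set: X].
  split=> // V mV ubV.
  have sub y : y <> x -> V y.
    move=> /nesym /(T_measurable_separate hT) [A [mA Ay nAx]].
    exact: (ubV A).
  (* [V] is [setT] or the complement of [[set x]], which is not measurable. *)
  have Vx : V x.
    apply: contrapT => nVx; apply: nmx.
    suff -> : [set x] = ~` V by exact: measurableC.
    apply/seteqP; split=> [y -> //|y nVy] /=.
    by apply: contrapT => /sub.
  by move=> y _; have [->|/sub] := pselect (y = x).
have [S' [finS' S'S joinS']] := hC S Sm joinS.
have [A /S'S [_ nAx] Ax] :=
  finite_join_bigcup finS' (subset_trans S'S Sm) joinS' x.
exact: nAx.
Qed.

Lemma compact_measurable_finite d (X : measurableType d) :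
  compact_measurable_space X -> (forall x : X, measurable [set x]) ->
  finite_set [set: X].
Proof.
move=> hC m1.
pose S : set (set X) := range set1.
have Sm : S `<=` measurable by move=> _ [x _ <-].
have joinS : is_join measurable S [set: X].
  by split=> // V _ ubV x _; apply: (ubV [set x]) => //; exists x.
have [S' [finS' S'S joinS']] := hC S Sm joinS.
apply: (sub_finite_set (B := \bigcup_(A in S') A)).
  move=> x _.
  have [A S'A Ax] := finite_join_bigcup finS' (subset_trans S'S Sm) joinS' x.
  by exists A.
apply: bigcup_finite => // A /S'S [x _ <-]; exact: finite_set1.
Qed.

Lemma finite_set1_measurable d (X : measurableType d) (A : set X) :
  finite_set [set: X] -> (forall x : X, measurable [set x]) -> measurable A.
Proof.
move=> finX m1; rewrite -[A]image_id -bigcup_imset1.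
by apply: fin_bigcup_measurable => //; exact: sub_finite_set finX.
Qed.

(** * Maximal ideals of the ring of measurable functions *)

Lemma idealr_setP (A : comNzRingType) (I : set A) :
  idealr_closed (mem I) <->
  [/\ I 0, ~ I 1 & forall a u v, I u -> I v -> I (a * u + v)].
Proof.
split=> [[I0 I1 Imul]|[I0 I1 Imul]].
  split; [exact: set_mem|by move/mem_set; apply/negP|].
  by move=> a u v /mem_set Iu /mem_set Iv; apply: set_mem; exact: Imul.
split; [exact: mem_set|by apply/negP => /set_mem|].
by move=> a u v /set_mem Iu /set_mem Iv; apply: mem_set; exact: Imul.
Qed.

Section vanishing_ideal.
Context d (X : measurableType d) (R : realType).
Implicit Types (x : X) (f : {mfun X >-> R}) (I : set (meas_ring X R)).

Definition vanishing_ideal x : set (meas_ring X R) :=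
  [set f | (f : {mfun X >-> R}) x = 0].

(** The ideal is the kernel of a surjection onto a field. Concretely, a
    function [f] with [f x != 0] generates 1 modulo the ideal:
    [1 = (f x)^-1 * f + (1 - (f x)^-1 * f)], whose last term vanishes at [x]. *)
Lemma vanishing_ideal_maximal x : maximal_ideal (vanishing_ideal x).
Proof.
split.
  apply/idealr_setP; split=> [//||a u v ux vx].
    by rewrite /vanishing_ideal /= => /eqP; rewrite oner_eq0.
  transitivity ((a : {mfun X >-> R}) x * (u : {mfun X >-> R}) x
                + (v : {mfun X >-> R}) x) => //.
  by rewrite ux vx mulr0 addr0.
move=> J /idealr_setP[J0 J1 Jmul] subJ; apply/seteqP; split=> // f Jf.
apply: contrapT => /eqP fx0; apply: J1.
pose a := (f : {mfun X >-> R}) x.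
pose c : meas_ring X R := (cst a^-1 : {mfun X >-> R}).
have -> : 1 = c * f + (1 - c * f) by rewrite addrC subrK.
apply: Jmul => //; apply: subJ.
by transitivity (1 - a^-1 * a) => //; rewrite mulVf// subrr.
Qed.

Definition point_spec x : max_spec (meas_ring X R) :=
  exist _ (vanishing_ideal x) (vanishing_ideal_maximal x).

Lemma point_spec_inj : T_measurable_space X -> injective point_spec.
Proof.
move=> hT x y /(congr1 (@sval _ _)) /= xy; apply: contrapT => /nesym nxy.
have [A [mA Ax nAy]] := T_measurable_separate hT nxy.
have : vanishing_ideal y (indic_mfun A mA : {mfun X >-> R}).
  by rewrite /vanishing_ideal /= /mindic indicE memNset.
rewrite -xy /vanishing_ideal /= /mindic indicE mem_set// => /eqP.
by rewrite oner_eq0.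
Qed.

(** [f] is invertible at [x], so it can be multiplied by the function that is
    [(f x)^-1] at [x] and zero elsewhere. *)
Lemma ideal_indic_set1 I f x (mx : measurable [set x]) :
  idealr_closed (mem I) -> I f -> f x != 0 ->
  I (indic_mfun [set x] mx : {mfun X >-> R}).
Proof.
move=> /idealr_setP[I0 _ Imul] If fx0.
pose e : {mfun X >-> R} := indic_mfun [set x] mx.
pose c : {mfun X >-> R} := cst (f x)^-1.
suff -> : indic_mfun [set x] mx = (c * e) * f + 0 :> meas_ring X R by exact: Imul.
apply/mfuneqP => y; rewrite -[RHS]/((f x)^-1 * e y * f y + 0) addr0.
rewrite /e /= /mindic indicE.
have [->|yx] := eqVneq y x; first by rewrite mem_set//= mulr1 mulVf.
by rewrite memNset ?mulr0 ?mul0r//=; apply/eqP.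
Qed.

Lemma ideal_vanishes_somewhere I :
  finite_set [set: X] -> (forall x : X, measurable [set x]) ->
  idealr_closed (mem I) -> exists x, I `<=` vanishing_ideal x.
Proof.
move=> finX m1 idI; apply: contrapT => noX.
have Ie x : I (indic_mfun [set x] (m1 x) : {mfun X >-> R}).
  have [f If fx0] : exists2 f : {mfun X >-> R}, I f & f x != 0.
    apply: contrapT => nof; apply: noX; exists x => f If.
    by apply: contrapT => /eqP fx0; apply: nof; exists f.
  exact: ideal_indic_set1 fx0.
have /idealr_setP[I0 I1 Imul] := idI; apply: I1.
pose s := finmap.enum_fset (fset_set [set: X]).
suff -> : (1 : meas_ring X R) =
    \sum_(x <- s) (indic_mfun [set x] (m1 x) : {mfun X >-> R}).
  apply: (big_ind (fun f : meas_ring X R => I f)) => // u v Iu Iv.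
  by rewrite -[u]mul1r; exact: Imul.
apply/mfuneqP => y; rewrite mfun_sum (bigD1_seq y) ?finmap.fset_uniq//=; last first.
  by rewrite in_fset_set// inE.
rewrite /mindic indicE mem_set// big1 ?addr0// => x xy.
by rewrite indicE memNset//= => yx; rewrite yx eqxx in xy.
Qed.

Lemma point_spec_surj :
  finite_set [set: X] -> (forall x : X, measurable [set x]) ->
  forall M : max_spec (meas_ring X R), exists x, point_spec x = M.
Proof.
move=> finX m1 [I maxI].
have [x Ix] := ideal_vanishes_somewhere finX m1 maxI.1.
exists x; apply: eq_exist => /=.
exact: maxI.2 (vanishing_ideal_maximal x).1 Ix.
Qed.

(** [A] consists of the zeros of the indicator of its complement. *)
Lemma max_spec_measurable_image (A : set X) :
  (forall M : max_spec (meas_ring X R), exists x, point_spec x = M) ->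
  measurable A -> max_spec_measurable (point_spec @` A).
Proof.
move=> surj mA.
pose g : {mfun X >-> R} := indic_mfun (~` A) (measurableC mA).
exists g => //; apply/seteqP; split=> M.
  have [x <-] := surj M; rewrite /zero_set /= /vanishing_ideal /=.
  rewrite /mindic indicE => gx; exists x => //; apply: contrapT => nAx.
  by move: gx; rewrite mem_set//= => /eqP; rewrite oner_eq0.
move=> [x Ax <-]; rewrite /zero_set /= /vanishing_ideal /=.
by rewrite /mindic indicE memNset//= => /(_ Ax).
Qed.

End vanishing_ideal.

(** Since all subsets of [X] are measurable, so are all subsets of the maximal
    spectrum, and any bijection is a homeomorphism. *)
Theorem proposition23 (R : realType) (d : measure_display)
    (X : measurableType d) (hcompact : compact_measurable_space X)
    (hT : T_measurable_space X) :
  sigma_algebra [set: max_spec (meas_ring X R)] (@max_spec_measurable (meas_ring X R)) /\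
  measurably_homeomorphic (@measurable d X) (@max_spec_measurable (meas_ring X R)).
Proof.
have m1 (x : X) : measurable [set x] by exact: compact_T_measurable_set1.
have finX := compact_measurable_finite hcompact m1.
have mX (A : set X) : measurable A by exact: finite_set1_measurable.
have surj := @point_spec_surj d X R finX m1.
have mall (B : set (max_spec (meas_ring X R))) : max_spec_measurable B.
  have -> : B = @point_spec d X R @` (@point_spec d X R @^-1` B).
    apply/seteqP; split=> [M BM|_ [x Bx <-] //].
    by have [x xM] := surj M; exists x => //=; rewrite xM.
  exact: max_spec_measurable_image.
split; first by split=> *; exact: mall.
exists (@point_spec d X R) => [|A]; last by split=> _; [exact: mall|exact: mX].
rewrite -setTT_bijective; split=> //.
- by move=> x y _ _; exact: point_spec_inj.
- by move=> M _; have [x <-] := surj M; exists x.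
Qed.
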